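(* Let $\bar y\in \mathcal S(\bar x)$. Suppose that the solution map $\mathcal S$ is inner semi-continuous at $(\bar x,\bar y)$ and that the local error bound holds for the system $g(x,y)\le 0$ at $(\bar x,\bar y)$. Then $V=-v$ is continuous at $\bar x$ and $$\partial v(\bar x)\subseteq\{-\nabla_x \mathcal L(\bar x,\bar y,\lambda):\lambda\in\Sigma(\bar x,\bar y)\},\qquad \partial^\infty v(\bar x)\subseteq\{\nabla_x g(\bar x,\bar y)\lambda:\lambda\in\Sigma^0(\bar x,\bar y)\}.$$ Assume further that $\{\nabla_x g(\bar x,\bar y)\lambda:\lambda\in\Sigma^0(\bar x,\bar y)\}=\{0\}$. Then $V$ is Lipschitz continuous at $\bar x$ and $$\partial V(\bar x)\subseteq\partial^c V(\bar x)\subseteq\{\nabla_x\mathcal L(\bar x,\bar y,\lambda):\lambda\in\Sigma(\bar x,\bar y)\}.$$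
   Context: Let $f:\mathbb R^{n+m}\to\mathbb R$ and $g:\mathbb R^{n+m}\to\mathbb R^q$ be continuously differentiable. For $x\in\mathbb R^n$ let $\mathcal F(x)=\{y\in\mathbb R^m:g(x,y)\le0\}$, $V(x)=\sup\{f(x,y):y\in\mathcal F(x)\}$ (with $V(x)=-\infty$ if $\mathcal F(x)=\emptyset$), $v(x)=\inf\{-f(x,y):y\in\mathcal F(x)\}=-V(x)$, and $\mathcal S(x)=\{y\in\mathcal F(x):f(x,y)=V(x)\}$. For a vector-valued map, $\nabla$ denotes the transposed Jacobian (so $\nabla_x g\in\mathbb R^{n\times q}$, $\nabla_y g\in\mathbb R^{m\times q}$). $\mathcal L(x,y,\lambda)=f(x,y)-g(x,y)^\top\lambda$, $$\Sigma(x,y)=\{\lambda:\nabla_y\mathcal L(x,y,\lambda)=0,\ 0\le -g(x,y)\perp\lambda\ge0\},$$ $$\Sigma^0(x,y)=\{\lambda:\nabla_y g(x,y)\lambda=0,\ 0\le -g(x,y)\perp\lambda\ge0\}.$$ Inner semi-continuity of $\mathcal S$ at $(\bar x,\bar y)$: for any sequence $x^k\to\bar x$ there exists a sequence $y^k\in\mathcal S(x^k)$ converging to $\bar y$. Local error bound for $g(x,y)\le0$ at $(\bar x,\bar y)$: there are $\kappa,\delta>0$ such that $\mathrm{dist}((x,y),\{(x',y'):g(x',y')\le0\})\le\kappa\sum_{i=1}^q\max\{g_i(x,y),0\}$ for all $(x,y)$ in the ball of radius $\delta$ about $(\bar x,\bar y)$. For $\varphi:\mathbb R^n\to[-\infty,\infty]$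 finite at $x^*$: $\widehat\partial\varphi(x^* )=\{w:\varphi(x)\ge\varphi(x^* )+w^\top(x-x^* )+o(\|x-x^*\|)\}$; the limiting subdifferential $\partial\varphi(x^* )$ is the set of limits of $w^k\in\widehat\partial\varphi(x^k)$ with $x^k\to x^*$, $\varphi(x^k)\to\varphi(x^* )$; the horizon subdifferential $\partial^\infty\varphi(x^* )$ is the set of limits of $t_kw^k$ with $w^k\in\widehat\partial\varphi(x^k)$, $x^k\to x^*$, $\varphi(x^k)\to\varphi(x^* )$, $t_k\downarrow0$. If $\varphi$ is Lipschitz continuous at $x^*$ (i.e. finite and Lipschitz on a neighborhood of $x^*$), $\partial^c\varphi(x^* )=\mathrm{co}\,\partial\varphi(x^* )$ is the Clarke subdifferential. *)

(* Defs.v *)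
From mathcomp Require Import all_boot all_order all_algebra.
From mathcomp Require Import all_classical all_reals all_analysis.

Set Implicit Arguments.
Unset Strict Implicit.
Unset Printing Implicit Defensive.

Import Order.TTheory GRing.Theory Num.Theory.
Import numFieldNormedType.Exports.

Local Open Scope classical_set_scope.
Local Open Scope ring_scope.

(* Points of R^k are row vectors; gradients, multipliers and subgradients are
   column vectors, so that x *m w is the pairing w^T x.  For a row-vector-valued
   map h, the library's jacobian 'J h z : 'M_(k, q) acts by v |-> v *m 'J h z;
   it is therefore the transposed Jacobian (columns are gradients). *)

(* Euclidean norm: the norm `|z| of the library on matrices is the max norm. *)
Definition enorm {R : realType} {k : nat} (z : 'rV[R]_k) : R :=
  Num.sqrt (\sum_(i < k) z 0 i ^+ 2).

Section Subdifferentials.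
Context {R : realType} {n : nat}.
Implicit Types (phi : 'rV[R]_n -> \bar R) (xs : 'rV[R]_n).

Definition regular_subdiff phi xs : set 'cV[R]_n :=
  [set w | phi xs \is a fin_num /\
    exists r : 'rV[R]_n -> R, (r =o_xs (fun x => enorm (x - xs))) /\
      \forall x \near xs,
        (phi xs + (((x - xs) *m w) 0 0 + r x)%:E <= phi x)%E].

Definition limiting_subdiff phi xs : set 'cV[R]_n :=
  [set w | phi xs \is a fin_num /\
    exists (xk : nat -> 'rV[R]_n) (wk : nat -> 'cV[R]_n),
      [/\ xk k @[k --> \oo] --> xs,
          phi (xk k) @[k --> \oo] --> phi xs,
          (forall k, regular_subdiff phi (xk k) (wk k)) &
          wk k @[k --> \oo] --> w]].

Definition horizon_subdiff phi xs : set 'cV[R]_n :=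
  [set w | phi xs \is a fin_num /\
    exists (xk : nat -> 'rV[R]_n) (wk : nat -> 'cV[R]_n) (tk : nat -> R),
      [/\ xk k @[k --> \oo] --> xs,
          phi (xk k) @[k --> \oo] --> phi xs,
          (forall k, regular_subdiff phi (xk k) (wk k)),
          (forall k, 0 < tk k) /\ tk k @[k --> \oo] --> (0 : R) &
          tk k *: wk k @[k --> \oo] --> w]].

Definition lipschitz_at phi xs : Prop :=
  exists (K : R) (U : set 'rV[R]_n),
    [/\ nbhs xs U,
        (forall x, U x -> phi x \is a fin_num) &
        forall x x', U x -> U x' ->
          `|fine (phi x) - fine (phi x')| <= K * enorm (x - x')].

Definition convex_hull (A : set 'cV[R]_n) : set 'cV[R]_n :=
  smallest (fun C : set (convex_lmodType 'cV[R]_n) => convex_set C) A.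

(* Meaningful only when phi is Lipschitz at xs. *)
Definition clarke_subdiff phi xs : set 'cV[R]_n :=
  convex_hull (limiting_subdiff phi xs).

End Subdifferentials.

Section Smoothness.
Context {R : realType} {k : nat}.

Definition grad (h : 'rV[R]_k -> R) (z : 'rV[R]_k) : 'cV[R]_k :=
  \col_i 'D_(delta_mx 0 i) h z.

Definition C1_scalar (h : 'rV[R]_k -> R) : Prop :=
  (forall z, differentiable h z) /\ continuous (grad h).

Definition C1_vector {q : nat} (h : 'rV[R]_k -> 'rV[R]_q) : Prop :=
  (forall z, differentiable h z) /\ continuous (jacobian h).

End Smoothness.

Section ValueFunction.
Context {R : realType} {n m q : nat}.
Variables (f : 'rV[R]_(n + m) -> R) (g : 'rV[R]_(n + m) -> 'rV[R]_q).
Implicit Types (x : 'rV[R]_n) (y : 'rV[R]_m) (l : 'cV[R]_q).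

Definition feasible x : set 'rV[R]_m :=
  [set y | forall i, g (row_mx x y) 0 i <= 0].

Definition Vsup x : \bar R :=
  ereal_sup [set (f (row_mx x y))%:E | y in feasible x].

Definition vinf x : \bar R :=
  ereal_inf [set (- f (row_mx x y))%:E | y in feasible x].

Definition solutions x : set 'rV[R]_m :=
  [set y | feasible x y /\ (f (row_mx x y))%:E = Vsup x].

Lemma vinfE x : vinf x = (- Vsup x)%E.
Proof.
rewrite /vinf /Vsup /ereal_inf; congr (- ereal_sup _)%E.
rewrite image_comp; apply: eq_imagel => y _ /=.
by rewrite opprK.
Qed.

Definition inner_semicontinuous (xs : 'rV[R]_n) (ys : 'rV[R]_m) : Prop :=
  forall xk : nat -> 'rV[R]_n, xk k @[k --> \oo] --> xs ->
    exists yk : nat -> 'rV[R]_m,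
      (forall k, solutions (xk k) (yk k)) /\ yk k @[k --> \oo] --> ys.

(* The distance is valued in \bar R, so that it is +oo for the empty set. *)
Definition dist_to (z : 'rV[R]_(n + m)) (A : set 'rV[R]_(n + m)) : \bar R :=
  ereal_inf [set (enorm (z - z'))%:E | z' in A].

Definition local_error_bound (xs : 'rV[R]_n) (ys : 'rV[R]_m) : Prop :=
  exists kappa delta : R, [/\ 0 < kappa, 0 < delta &
    forall z : 'rV[R]_(n + m), enorm (z - row_mx xs ys) < delta ->
      (dist_to z [set z' | forall i, (g z' 0 i <= 0)%R]
       <= (kappa * \sum_(i < q) Num.max (g z 0 i) 0)%:E)%E].

Definition nabla_x_g x y : 'M[R]_(n, q) := usubmx ('J g (row_mx x y)).
Definition nabla_y_g x y : 'M[R]_(m, q) := dsubmx ('J g (row_mx x y)).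

Definition lagrangian l (z : 'rV[R]_(n + m)) : R := f z - (g z *m l) 0 0.

Definition nabla_x_L x y l : 'cV[R]_n :=
  usubmx (grad (lagrangian l) (row_mx x y)).
Definition nabla_y_L x y l : 'cV[R]_m :=
  dsubmx (grad (lagrangian l) (row_mx x y)).

Definition complementary x y l : Prop :=
  [/\ (forall i, 0 <= - g (row_mx x y) 0 i),
      (forall i, 0 <= l i 0) &
      - g (row_mx x y) *m l = 0].

Definition Sigma x y : set 'cV[R]_q :=
  [set l | nabla_y_L x y l = 0 /\ complementary x y l].

Definition Sigma0 x y : set 'cV[R]_q :=
  [set l | nabla_y_g x y *m l = 0 /\ complementary x y l].

End ValueFunction.

(* Main.v *)
Require Import Defs.
From mathcomp Require Import all_boot all_order all_algebra.
From mathcomp Require Import all_classical all_reals all_analysis.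
From mathcomp Require Import ring lra.
Import Order.TTheory GRing.Theory Num.Theory.
Import numFieldNormedType.Exports.
Local Open Scope classical_set_scope.
Local Open Scope ring_scope.

(** Inner semi-continuity, applied to sequences that begin at an arbitrary
    point, says that every [x] has a maximiser, and that for [x] near [xbar]
    there is one near [ybar]. So [V] is finite, [V x = f z] for a feasible [z =
    (x, y)] near [zbar = (xbar, ybar)], and continuity of [V] at [xbar] is that
    of [f].

    The multipliers come from one inequality and one duality argument. Let [T
    d] be the sum over the constraints active at [zbar] of the positive parts
    of their derivatives in the direction [d]. By the error bound, moving a
    feasible [z] near [zbar] by [t d] can be repaired into a feasible point at
    cost [t (kappa T d + e)] ([feasible_shift]). If [u] is a regular
    subgradient of [v = - V] at [x], then [z] minimises [- f - <u, .>] over the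
    feasible set up to a first-order error; comparing it with the repaired
    point and passing to the limit gives [<eta, d> <= M T d] for all [d], where
    [eta] is the limit of the scaled vectors [(u, 0) + grad f]
    ([subgradient_estimate]). Such an inequality says that [eta] lies in the
    support set of [M T], that is, that [eta] is a combination of the active
    gradients with coefficients in [0, M] ([box_multiplier]). Scale factors
    tending to 1 give the bound on the limiting subdifferential, scale factors
    tending to 0 the one on the horizon subdifferential. As the estimate passes
    to the limit before any multiplier is chosen, no sequence of multipliers
    has to be bounded or to converge.

    If the horizon bound is trivial, then regular subgradients of [v] are
    bounded near [xbar]: otherwise their normalisations would accumulate at a
    unit vector of the horizon subdifferential. Bounded subgradients give a
    Lipschitz constant by minimising [v + K |. - a|] over a small ball: a
    minimiser other than [a] would carry a subgradient of norm [K]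
    ([lipschitz_of_trivial_horizon]).

    A regular subgradient [w] of [V] itself bounds [v] from above, so the
    argument for [v] does not apply. Instead one starts at a maximiser over [x'
    = x - t d_x], shifts it by [t d] and repairs it; the result lies over a
    point close to [x], and the Lipschitz bound compares its value with [V x].
    This gives the same inequality [<eta, d> <= M T d] for [(- w, 0) + grad f]
    ([supergradient_estimate]), with no recourse to a calculus of Clarke
    subgradients. The set of the [nabla_x_L] over [Sigma] is convex, and so
    contains the Clarke subdifferential. *)

Local Notation dot d w := ((d *m w) 0 0).

(** * Norms, pairings and multipliers *)

Section Norms.
Context {R : realType}.

Lemma entry_norm_le {m n : nat} (M : 'M[R]_(m, n)) i j : `|M i j| <= `|M|.
Proof.
rewrite [leRHS]/Num.Def.normr /= mx_normrE.
exact: (le_bigmax _ (fun ij => `|M ij.1 ij.2|) (i, j)).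
Qed.

Lemma mx_norm_le {m n : nat} (M : 'M[R]_(m, n)) (e : R) :
  0 <= e -> (forall i j, `|M i j| <= e) -> `|M| <= e.
Proof.
move=> e0 Me; rewrite [leLHS]/Num.Def.normr /= mx_normrE.
by apply: bigmax_le => // -[i j] _; exact: Me.
Qed.

Lemma row_mx_norm_le {k n m : nat} (a : 'M[R]_(k, n)) (b : 'M[R]_(k, m)) e :
  `|a| <= e -> `|b| <= e -> `|row_mx a b| <= e.
Proof.
move=> ae be; apply: mx_norm_le => [|i j]; first exact: le_trans ae.
rewrite mxE; case: (fintype.split j) => j'.
  exact: le_trans (entry_norm_le _ _ _) ae.
exact: le_trans (entry_norm_le _ _ _) be.
Qed.

Lemma normr_trmx {a b : nat} (A : 'M[R]_(a, b)) : `|A^T| = `|A|.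
Proof.
apply/le_anti/andP; split; apply: mx_norm_le => // i j.
  by rewrite mxE entry_norm_le.
by rewrite -[A]trmxK mxE trmxK entry_norm_le.
Qed.

Lemma lsubmx_norm_le {k n m : nat} (z : 'M[R]_(k, n + m)) : `|lsubmx z| <= `|z|.
Proof. by apply: mx_norm_le => // i j; rewrite mxE entry_norm_le. Qed.

Lemma dotDl {k : nat} (d e : 'rV[R]_k) (w : 'cV[R]_k) :
  dot (d + e) w = dot d w + dot e w.
Proof. by rewrite mulmxDl mxE. Qed.

Lemma dotBl {k : nat} (d e : 'rV[R]_k) (w : 'cV[R]_k) :
  dot (d - e) w = dot d w - dot e w.
Proof. by rewrite mulmxBl !mxE. Qed.

Lemma dotZl {k : nat} t (d : 'rV[R]_k) (w : 'cV[R]_k) :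
  dot (t *: d) w = t * dot d w.
Proof. by rewrite -scalemxAl mxE. Qed.

Lemma dotDr {k : nat} (d : 'rV[R]_k) (v w : 'cV[R]_k) :
  dot d (v + w) = dot d v + dot d w.
Proof. by rewrite mulmxDr mxE. Qed.

Lemma dotBr {k : nat} (d : 'rV[R]_k) (v w : 'cV[R]_k) :
  dot d (v - w) = dot d v - dot d w.
Proof. by rewrite mulmxBr !mxE. Qed.

Lemma dotZr {k : nat} t (d : 'rV[R]_k) (w : 'cV[R]_k) :
  dot d (t *: w) = t * dot d w.
Proof. by rewrite -scalemxAr mxE. Qed.

Lemma dot_norm_le {k : nat} (d : 'rV[R]_k) (w : 'cV[R]_k) :
  `|dot d w| <= k%:R * `|d| * `|w|.
Proof.
rewrite mxE (le_trans (ler_norm_sum _ _ _))//.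
apply: (@le_trans _ _ (\sum_(i < k) `|d| * `|w|)).
  by apply: ler_sum => i _; rewrite normrM ler_pM ?entry_norm_le.
by rewrite sumr_const card_ord -mulrA mulr_natl.
Qed.

Lemma dot_tr_self {k : nat} (z : 'rV[R]_k) : dot z z^T = \sum_i z 0 i ^+ 2.
Proof. by rewrite mxE; apply: eq_bigr => i _; rewrite mxE expr2. Qed.

Lemma dot_tr_self_ge0 {k : nat} (z : 'rV[R]_k) : 0 <= dot z z^T.
Proof. by rewrite dot_tr_self sumr_ge0 // => i _; exact: sqr_ge0. Qed.

Lemma dot_tr_self_le0 {k : nat} (z : 'rV[R]_k) : dot z z^T <= 0 -> z = 0.
Proof.
rewrite dot_tr_self => z0; apply/rowP => i; rewrite mxE; apply/eqP.
rewrite -sqrf_eq0 eq_le sqr_ge0 andbT (le_trans _ z0)//.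
by rewrite (bigD1 i)//= lerDl sumr_ge0 // => j _; exact: sqr_ge0.
Qed.

Lemma dot_tr_sym {k : nat} (d s : 'rV[R]_k) : dot s d^T = dot d s^T.
Proof. by rewrite -[in RHS](trmxK d) -trmx_mul [RHS]mxE. Qed.

Lemma dot_tr_selfB {k : nat} e (d s : 'rV[R]_k) :
  dot (d - e *: s) (d - e *: s)^T =
  dot d d^T - 2 * e * dot d s^T + e ^+ 2 * dot s s^T.
Proof.
have -> : (d - e *: s)^T = d^T - e *: s^T by rewrite linearB linearZ.
rewrite !(dotBl, dotBr, dotZl, dotZr) (dot_tr_sym d s); ring.
Qed.

Lemma enormE {k : nat} (z : 'rV[R]_k) : enorm z = Num.sqrt (dot z z^T).
Proof. by rewrite dot_tr_self. Qed.

Lemma sqr_enorm {k : nat} (z : 'rV[R]_k) : enorm z ^+ 2 = dot z z^T.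
Proof. by rewrite enormE sqr_sqrtr // dot_tr_self_ge0. Qed.

Lemma enorm_ge0 {k : nat} (z : 'rV[R]_k) : 0 <= enorm z.
Proof. exact: sqrtr_ge0. Qed.

Lemma enormZ {n : nat} (c : R) (z : 'rV[R]_n) : enorm (c *: z) = `|c| * enorm z.
Proof.
rewrite !enormE linearZ /= dotZl dotZr mulrA -expr2 sqrtrM ?sqr_ge0//.
by rewrite sqrtr_sqr.
Qed.

Lemma norm_le_enorm {k : nat} (z : 'rV[R]_k) : `|z| <= enorm z.
Proof.
apply: mx_norm_le => [|i j]; first exact: enorm_ge0.
rewrite (ord1 i) -(@ler_pXn2r _ 2) ?nnegrE ?enorm_ge0//.
rewrite real_normK ?num_real// sqr_enorm dot_tr_self (bigD1 j)//=.
by rewrite lerDl sumr_ge0 // => l _; exact: sqr_ge0.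
Qed.

Lemma enorm_le_norm {k : nat} (z : 'rV[R]_k) : enorm z <= k%:R * `|z|.
Proof.
rewrite -(@ler_pXn2r _ 2) ?nnegrE ?enorm_ge0 ?mulr_ge0//.
rewrite sqr_enorm (le_trans (ler_norm _))// (le_trans (dot_norm_le _ _))//.
rewrite normr_trmx.
case: k z => [|k] z; first by rewrite !mul0r expr0n.
rewrite exprMn expr2 -!mulrA ler_wpM2l//.
by rewrite -expr2 ler_peMl ?sqr_ge0// ler1n.
Qed.

Lemma enorm_gt0 {k : nat} (z : 'rV[R]_k) : z != 0 -> 0 < enorm z.
Proof. by rewrite -normr_gt0 => /lt_le_trans; apply; exact: norm_le_enorm. Qed.

Lemma enorm0 {k : nat} : enorm (0 : 'rV[R]_k) = 0.
Proof. by rewrite enormE mul0mx mxE sqrtr0. Qed.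

Lemma continuous_fsum {T : topologicalType} {q : nat} (h : 'I_q -> T -> R) :
  (forall i, continuous (h i)) -> continuous (fun x => \sum_i h i x).
Proof.
by move=> hc; apply: continuous_big => //; exact: add_continuous.
Qed.

Lemma rV_entry_affine {p : nat} (v : 'rV[R]_p) i (c e : R) :
  {for v, continuous (fun z : 'rV[R]_p => z 0 i * c + e)}.
Proof.
have vi : z 0 i @[z --> v] --> v 0 i by exact: coord_continuous.
apply: (cvgD (cvgM vi (cvg_cst c)) (cvg_cst e)).
Qed.

Lemma dot_tr_self_continuous {p k : nat} (h : 'rV[R]_p -> 'rV[R]_k) :
  (forall i, continuous (fun z : 'rV[R]_p => h z 0 i)) ->
  continuous (fun z : 'rV[R]_p => dot (h z) (h z)^T).
Proof.
move=> hc.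
have -> : (fun z => dot (h z) (h z)^T) = fun z => \sum_i h z 0 i * h z 0 i.
  apply/funext => v; rewrite dot_tr_self.
  by apply: eq_bigr => i _; exact: expr2.
by apply: continuous_fsum => i z; exact: cvgM (hc i z) (hc i z).
Qed.

Lemma enorm_continuous {k : nat} (a : 'rV[R]_k) :
  continuous (fun z : 'rV[R]_k => enorm (z - a)).
Proof.
move=> z.
have -> : (fun z => enorm (z - a)) =
    Num.sqrt \o (fun z => dot (z - a) (z - a)^T).
  by apply/funext => v; rewrite enormE.
apply: continuous_comp; last exact: sqrt_continuous.
apply: dot_tr_self_continuous => i v.
have -> : (fun z : 'rV[R]_k => (z - a) 0 i) = fun z => z 0 i * 1 + - a 0 i.
  by apply/funext => u; rewrite !mxE mulr1.
exact: rV_entry_affine.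
Qed.

(** Estimates below hold up to an error linear in a small parameter; this lets
    the parameter go to 0 without naming limits. *)
Lemma ler_addMeps (a b C : R) :
  (forall e, 0 < e -> e < 1 -> a <= b + C * e) -> a <= b.
Proof.
move=> H; apply/ler_addgt0Pr => e e0.
have C0 : 0 < `|C| + 1 by rewrite ltr_wpDl.
pose e' := Num.min (e / (`|C| + 1)) 2^-1.
have e'0 : 0 < e' by rewrite lt_min divr_gt0//= invr_gt0.
have e'1 : e' < 1 by rewrite gt_min; apply/orP; right; lra.
apply: le_trans (H _ e'0 e'1) _; rewrite lerD2l.
apply: le_trans (ler_norm _) _; rewrite normrM (gtr0_norm e'0).
apply: (@le_trans _ _ ((`|C| + 1) * e')).
  by rewrite ler_wpM2r ?lerDl ?ltW.
by rewrite mulrC -ler_pdivlMr// ge_min lexx.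
Qed.

End Norms.

Section BoxMultiplier.
Context {R : realType} {k q : nat}.

(** The right-hand side of the hypothesis is the support function of the convex
    compact set of the [A *m l] with [l] supported on [P] and entries in [0,
    M], so the hypothesis is that [eta] is not separated from that set. The
    proof projects [eta] on it: for the residual [d], the variational
    inequality of the projection, tested against the vertex [mu] that maximises
    [<d, A mu>], says that [|d|^2 <= 0]. *)
Lemma box_multiplier (A : 'M[R]_(k, q)) (P : pred 'I_q) (M : R)
    (eta : 'cV[R]_k) :
  0 <= M ->
  (forall d : 'rV[R]_k,
    dot d eta <= M * \sum_(i | P i) Num.max ((d *m A) 0 i) 0) ->
  exists l : 'cV[R]_q,
    [/\ forall i, 0 <= l i 0, forall i, ~~ P i -> l i 0 = 0 & eta = A *m l].
Proof.
move=> M0 H.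
pose top i := if P i then M else 0.
have top0 i : 0 <= top i by rewrite /top; case: ifP.
pose B : set 'rV[R]_q := [set u | forall i, `[0, top i]%classic (u 0 i)].
have cB : compact B.
  apply: (@rV_compact R q (fun i => `[0, top i]%classic)) => i.
  exact: segment_compact.
pose res (u : 'rV[R]_q) : 'rV[R]_k := eta^T - u *m A^T.
have resC : {within B, continuous (fun u => dot (res u) (res u)^T)}.
  apply: continuous_subspaceT; apply: dot_tr_self_continuous => i.
  have E v : res v 0 i = eta i 0 - \sum_j (v 0 j * A i j + 0).
    rewrite !mxE; congr (_ - _).
    by apply: eq_bigr => j _; rewrite mxE addr0.
  under eq_fun do rewrite E.
  have sc : continuous (fun v : 'rV[R]_q => \sum_j (v 0 j * A i j + 0)).
    apply: continuous_fsum => j v.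
    exact: rV_entry_affine.
  have dc (u : 'rV[R]_q) : eta i 0 - \sum_j (v 0 j * A i j + 0) @[v --> u] -->
      eta i 0 - \sum_j (u 0 j * A i j + 0).
    exact: (cvgB (cvg_cst _) (sc u)).
  by move=> u; exact: dc.
have B0 : B !=set0.
  by exists 0 => i /=; rewrite mxE in_itv /= lexx top0.
have [c /set_mem Bc cmin] := EVT_min_rV B0 cB resC.
set d := res c.
pose mu : 'rV[R]_q := \row_i (if 0 < (d *m A) 0 i then top i else 0).
have Bmu : B mu.
  by move=> i /=; rewrite mxE in_itv /=; case: ifP; rewrite ?lexx ?top0.
pose s : 'rV[R]_k := (mu - c) *m A^T.
(* The residual cannot decrease along the segment from [c] to [mu]. *)
have vi : dot d s^T <= 0.
  apply: (@ler_addMeps _ _ _ (dot s s^T)) => e e0 e1; rewrite add0r.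
  have Be : B (c + e *: (mu - c)).
    move=> i; move: (Bc i) (Bmu i); rewrite /= !mxE !in_itv /=.
    set m' := if _ then _ else _.
    by move=> /andP[? ?] /andP[? ?]; apply/andP; split; nra.
  have := cmin _ (mem_set Be).
  have -> : res (c + e *: (mu - c)) = d - e *: s.
    by rewrite /res /d /res /s mulmxDl -scalemxAl opprD addrA.
  rewrite -/d dot_tr_selfB => h; rewrite -(ler_pM2l e0).
  by have := dot_tr_self_ge0 s; nra.
have dA u : dot d (u *m A^T)^T = \sum_i u 0 i * (d *m A) 0 i.
  rewrite trmx_mul trmxK mulmxA mxE; apply: eq_bigr => i _.
  by rewrite [X in _ * X]mxE mulrC.
have dmu : dot d (mu *m A^T)^T = M * \sum_(i | P i) Num.max ((d *m A) 0 i) 0.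
  rewrite dA mulr_sumr [RHS]big_mkcond /=; apply: eq_bigr => i _.
  rewrite mxE /top; case: ltP => h; case: (P i); rewrite ?mul0r ?mulr0//.
have d0 : d = 0.
  apply: dot_tr_self_le0; apply: le_trans vi.
  have sE : s^T = (mu *m A^T)^T - (c *m A^T)^T by rewrite /s mulmxBl linearB.
  have dE : d^T = eta - (c *m A^T)^T by rewrite /d /res linearB /= trmxK.
  by rewrite sE dE !dotBr dmu lerD2r.
exists c^T; split => [i|i nPi|].
- by rewrite mxE; have := Bc i; rewrite /= in_itv /= => /andP[].
- rewrite mxE; have := Bc i; rewrite /= in_itv /= /top (negbTE nPi).
  by move=> /andP[? ?]; apply/le_anti/andP.
- apply: trmx_inj; rewrite trmx_mul trmxK; apply/eqP.
  by rewrite -subr_eq0 -[X in X == 0]/d d0.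
Qed.

End BoxMultiplier.

(** * Strict differentiability and regular subgradients *)

Lemma continuous_epsP {R : realType} {V W : normedModType R} (f : V -> W) x0 :
  {for x0, continuous f} <-> forall e, 0 < e -> exists2 r, 0 < r &
    forall x, `|x - x0| < r -> `|f x - f x0| < e.
Proof.
split=> [/cvgrPdist_lt fc e /fc /nbhs_ballP[r /= r0 rP]|fc].
  exists r => // x xr; rewrite distrC; apply: rP.
  by rewrite -ball_normE /= distrC.
apply/cvgrPdist_lt => e /fc[r r0 rP]; apply/nbhs_ballP; exists r => //= x.
by rewrite -ball_normE /= distrC => /rP; rewrite distrC.
Qed.

Section StrictDifferentiability.
Context {R : realType} {k : nat}.

Lemma deriveEgrad (h : 'rV[R]_k -> R) z v :
  differentiable h z -> 'D_v h z = dot v (grad h z).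
Proof.
move=> dh; rewrite deriveE // {1}[v]row_sum_delta linear_sum mxE.
by apply: eq_bigr => i _; rewrite linearZ /= mxE deriveE.
Qed.

Lemma is_derive_segment (h : 'rV[R]_k -> R) (z v : 'rV[R]_k) (t : R) :
  differentiable h (z + t *: v) ->
  is_derive t 1 (fun s : R => h (z + s *: v)) (dot v (grad h (z + t *: v))).
Proof.
move=> dh; rewrite -deriveEgrad //.
have E : (fun s : R =>
      s^-1 *: (h (z + (s *: (1 : R^o) + t) *: v) - h (z + t *: v))) =
    fun s : R => s^-1 *: (h (s *: v + (z + t *: v)) - h (z + t *: v)).
  apply/funext => s; congr (_ *: (h _ - _)).
  by rewrite scalerDl addrCA [s *: 1]mulr1.
apply: DeriveDef; last by rewrite /derive /= E.
by rewrite /derivable /= E; exact: diff_derivable.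
Qed.

(** The two points are independent, so that the increments are compared with
    the single gradient at [z0] while the base point [z] varies; this follows
    from the mean value theorem on the segment from [z] to [z']. *)
Lemma C1_strict_diff (h : 'rV[R]_k -> R) (z0 : 'rV[R]_k) :
  C1_scalar h -> forall e, 0 < e -> exists2 r, 0 < r &
    forall z z', `|z - z0| < r -> `|z' - z0| < r ->
      `|h z' - h z - dot (z' - z) (grad h z0)| <= e * `|z' - z|.
Proof.
move=> [dh ch] e e0.
have e'0 : 0 < e / (k.+1)%:R by rewrite divr_gt0.
have [r r0 rP] := (continuous_epsP _ _).1 (ch z0) _ e'0.
exists r => // z z' zr z'r; set v := z' - z.
have zc t : t \in `[0, 1]%R -> `|z + t *: v - z0| < r.
  rewrite in_itv /= => /andP[t0 t1].
  have -> : z + t *: v - z0 = (1 - t) *: (z - z0) + t *: (z' - z0).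
    by apply/rowP => i; rewrite /v !mxE; ring.
  apply: le_lt_trans (ler_normD _ _) _; rewrite !normrZ.
  rewrite (ger0_norm t0) ger0_norm ?subr_ge0//.
  have [->|t0'] := eqVneq t 0; first by rewrite subr0 mul1r mul0r addr0.
  have : 0 < t by rewrite lt_neqAle eq_sym t0'. nra.
have [||t t01] := @MVT_segment R (fun s => h (z + s *: v))
  (fun s => dot v (grad h (z + s *: v))) 0 1 ler01.
- by move=> t _; apply: is_derive_segment; exact: dh.
- apply: continuous_subspaceT => t; apply: differentiable_continuous.
  apply/derivable1_diffP; apply: (@ex_derive _ _ _ _ _ _ _
    (is_derive_segment _ _ _ _ (dh _))).
rewrite /= scale1r scale0r addr0 subr0 mulr1 [z + v]addrC subrK => ->.
rewrite -dotBr (le_trans (dot_norm_le _ _))//.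
have := rP _ (zc _ t01); rewrite ltr_pdivlMr// => /ltW le_e.
have := normr_ge0 v; have := normr_ge0 (grad h (z + t *: v) - grad h z0).
by rewrite -natr1 in le_e *; have : 0 <= k%:R :> R by []; nra.
Qed.

End StrictDifferentiability.

Section Coordinates.
Context {R : realType} {k q : nat}.
Implicit Types (g : 'rV[R]_k -> 'rV[R]_q) (z : 'rV[R]_k).

Lemma differentiable_entry g z i :
  differentiable g z -> differentiable (fun x => g x 0 i) z.
Proof.
move=> dg.
exact: (differentiable_comp (g := fun M : 'rV[R]_q => M 0 i) dg
  (differentiable_coord _ _ _)).
Qed.

Lemma grad_entry g z i :
  differentiable g z -> grad (fun x => g x 0 i) z = col i ('J g z).
Proof.
move=> dg; apply/colP => j; rewrite !mxE.
have dgj : derivable g z (delta_mx 0 j) by exact: diff_derivable.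
have := derive_mx dgj; rewrite deriveEjacobian // => /rowP/(_ i).
by rewrite -rowE !mxE => <-.
Qed.

Lemma C1_entry g i : C1_vector g -> C1_scalar (fun x => g x 0 i).
Proof.
move=> [dg cg]; split=> [z|]; first exact: differentiable_entry.
have -> : grad (fun x => g x 0 i) = fun z => col i ('J g z).
  by apply/funext => z; exact: grad_entry.
move=> z; apply/continuous_epsP => e /((continuous_epsP _ _).1 (cg z))[r r0 rP].
exists r => // x /rP; apply: le_lt_trans.
rewrite -raddfB; apply: mx_norm_le => // a b.
by rewrite mxE entry_norm_le.
Qed.

Lemma grad_lagrangian (f : 'rV[R]_k -> R) g (l : 'cV[R]_q) z :
  differentiable f z -> differentiable g z ->
  grad (fun x => f x - dot (g x) l) z = grad f z - 'J g z *m l.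
Proof.
move=> df dg; apply/colP => j; rewrite !mxE.
have dgi i : derivable (fun x => g x 0 i) z (delta_mx 0 j).
  by apply: diff_derivable; exact: differentiable_entry.
have -> : (fun x => f x - dot (g x) l) =
    f - \sum_i (l i 0 \*: (fun x => g x 0 i)).
  apply/funext => x; rewrite mxE !fctE; congr (_ - _).
  by rewrite fct_sumE; apply: eq_bigr => i _; rewrite mulrC.
have dl i : derivable (l i 0 \*: (fun x => g x 0 i)) z (delta_mx 0 j).
  exact: derivableZ.
rewrite deriveB; last 2 first.
- exact: diff_derivable.
- exact: derivable_sum.
congr (_ - _); rewrite derive_sum //; apply: eq_bigr => i _.
rewrite deriveZ // mulrC; congr (_ * _).
by have /colP/(_ j) := grad_entry g z i dg; rewrite !mxE.
Qed.

End Coordinates.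

Section RegularSubgradients.
Context {R : realType} {n : nat}.
Implicit Types (p : 'rV[R]_n -> R) (xs : 'rV[R]_n) (w : 'cV[R]_n).

Lemma regular_subdiff_eps p xs w : regular_subdiff (EFin \o p) xs w ->
  forall e, 0 < e -> exists2 r, 0 < r & forall x, `|x - xs| < r ->
    p xs + dot (x - xs) w - e * `|x - xs| <= p x.
Proof.
move=> [_ [rem [/eqoP oP near_le]]] e e0.
have e'0 : 0 < e / n.+1%:R by rewrite divr_gt0.
have near_both := filterI near_le (oP _ e'0).
have [r /= r0 rP] := (nbhs_ballP _ _).1 (near_both _).
exists r => // x xr; have xb : ball xs r x by rewrite -ball_normE /= distrC.
have [] := rP _ xb; rewrite lee_fin => le1 le2; apply: le_trans le1.
rewrite -addrA lerD2l lerD2l lerNl (le_trans (ler_norm _))// normrN.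
apply: le_trans le2 _; rewrite (ger0_norm (enorm_ge0 _)).
rewrite mulrAC ler_pdivrMr// -mulrA; apply: ler_wpM2l; first exact: ltW.
rewrite (le_trans (enorm_le_norm _))// mulrC; apply: ler_wpM2l => //.
by rewrite ler_nat.
Qed.

(** Converse of the previous lemma for the remainders met here: a quadratic one
    is [o(enorm (x - xs))]. *)
Lemma regular_subdiff_quadratic p xs w (C r : R) : 0 < r ->
  (forall x, `|x - xs| < r ->
    p xs + dot (x - xs) w - C * enorm (x - xs) ^+ 2 <= p x) ->
  regular_subdiff (EFin \o p) xs w.
Proof.
move=> r0 H; split => //; exists (fun x => - C * enorm (x - xs) ^+ 2); split.
  apply/eqoP => e e0.
  have [r' r'0 r'P] := (continuous_epsP _ _).1 (enorm_continuous xs xs) _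
    (divr_gt0 e0 (ltr_wpDl (normr_ge0 C) ltr01)).
  apply/nbhs_ballP; exists r' => //= x; rewrite -ball_normE /= distrC => /r'P.
  rewrite subrr enorm0 subr0 normrM normrN normrX (ger0_norm (enorm_ge0 _)).
  rewrite ltr_pdivlMr ?ltr_wpDl// => h.
  rewrite expr2 mulrA ler_wpM2r ?enorm_ge0//.
  have := normr_ge0 C; have := enorm_ge0 (x - xs); nra.
apply/nbhs_ballP; exists r => //= x; rewrite -ball_normE /= distrC => /H.
by rewrite lee_fin mulNr addrA.
Qed.

End RegularSubgradients.

Lemma uniform_radius {R : realType} {q : nat} (P : 'I_q -> R -> Prop) :
  (forall i r s, s <= r -> P i r -> P i s) ->
  (forall i, exists2 r, 0 < r & P i r) -> exists2 r, 0 < r & forall i, P i r.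
Proof.
move=> mono H.
pose r i := s2val (cid2 (H i)).
exists (\big[Num.min/1]_i r i).
  by apply: lt_bigmin => // i _; exact: (s2valP (cid2 (H i))).
by move=> i; apply: mono (s2valP' (cid2 (H i))); exact: bigmin_le_cond.
Qed.

(** Chooses the length of a step of speed [D], short enough both for the step
    size [t] and for the displacement [t * D]. *)
Lemma small_step {R : realType} (a b D : R) : 0 < a -> 0 < b -> 0 <= D ->
  exists t, [/\ 0 < t, t < a & t * D < b].
Proof.
move=> a0 b0 D0; have D1 : 0 < D + 1 by lra.
pose c := Num.min a (b / (D + 1)).
have c0 : 0 < c by rewrite lt_min a0 divr_gt0.
have ca : c <= a by rewrite ge_min lexx.
have cb : c * (D + 1) <= b by rewrite -ler_pdivlMr// ge_min lexx orbT.
by exists (c / 2); split; nra.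
Qed.

(** * Lipschitz continuity from a trivial horizon subdifferential *)

Section LipschitzCriterion.
Context {R : realType} {n : nat}.

(** Compactness of the unit sphere, for a family of predicates that shrinks as
    [e] decreases; it replaces the extraction of a convergent subsequence. *)
Lemma unit_accumulation (P : R -> 'rV[R]_n -> Prop) :
  (forall e e' v, e <= e' -> P e v -> P e' v) ->
  (forall e, 0 < e -> exists2 v, P e v & enorm v = 1) ->
  exists2 w, enorm w = 1 & forall e, 0 < e -> exists2 v, P e v & `|v - w| < e.
Proof.
move=> mono ex.
pose S := [set v : 'rV[R]_n | enorm v = 1].
have enormC : continuous (enorm : 'rV[R]_n -> R).
  move=> v; have := @enorm_continuous R n 0 v.
  by under eq_fun do rewrite subr0.
have cS : compact S.
  apply: bounded_closed_compact.
    exists 1; split => // M M1 v Sv; apply: le_trans (norm_le_enorm v) _.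
    by rewrite Sv ltW.
  rewrite (_ : S = enorm @^-1` [set 1]); last by apply/seteqP; split.
  by apply: preimage_closed => [v _|]; [exact: enormC|exact: closed_eq].
pose A e := [set v | P e v /\ enorm v = 1].
pose F := filter_from [set e : R | 0 < e] A.
have FF : Filter F.
  apply: filter_from_filter; first by exists 1; exact: ltr01.
  move=> e e' e0 e'0; exists (Num.min e e'); first by rewrite /= lt_min e0.
  move=> v [Pv v1].
  by split; split => //; apply: mono Pv; rewrite ge_min lexx ?orbT.
have PF : ProperFilter F.
  apply: filter_from_proper => e /ex[v Pv v1]; by exists v.
have FS : F S by exists 1; [exact: ltr01|move=> v []].
have [w [w1 cl]] := cS F PF FS.
exists w => // e e0.
have FA : F (A e) by exists e.
have [v [[Pv _] vw]] := cl _ _ FA (nbhsx_ballx w e e0).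
by exists v => //; move: vw; rewrite -ball_normE /= distrC.
Qed.

(** Away from its centre the penalty [K * enorm (. - a)] is smooth with
    gradient of norm [K], so a minimiser other than [a] has the opposite of
    that gradient as a subgradient. *)
Lemma penalty_subgradient (p : 'rV[R]_n -> R) (a xs : 'rV[R]_n) (K r : R) :
  0 <= K -> 0 < r -> xs != a ->
  (forall x, `|x - xs| < r ->
    p xs + K * enorm (xs - a) <= p x + K * enorm (x - a)) ->
  regular_subdiff (EFin \o p) xs (- (K / enorm (xs - a)) *: (xs - a)^T).
Proof.
move=> K0 r0 xsa pmin; set E := enorm (xs - a).
have E0 : 0 < E by rewrite enorm_gt0 // subr_eq0.
apply: (regular_subdiff_quadratic _ _ _ (K / (2 * E)) r r0) => x xr.
have := pmin _ xr; rewrite -/E => le_p.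
set G := enorm (x - a) in le_p.
have G2 : G ^+ 2 = E ^+ 2 + 2 * dot (x - xs) (xs - a)^T + enorm (x - xs) ^+ 2.
  have -> : G = enorm (x - xs - (-1) *: (xs - a)).
    by congr enorm; apply/rowP => i; rewrite !mxE; ring.
  by rewrite !sqr_enorm dot_tr_selfB; ring.
(* Concavity of the square root: a quadratic upper bound on [enorm]. *)
have GE : G - E <= (G ^+ 2 - E ^+ 2) / (2 * E).
  by rewrite ler_pdivlMr ?mulr_gt0//; have := sqr_ge0 (G - E); nra.
rewrite dotZr.
have : K * (G - E) <= K * ((G ^+ 2 - E ^+ 2) / (2 * E)) by rewrite ler_wpM2l.
have -> : K * ((G ^+ 2 - E ^+ 2) / (2 * E)) =
    K / E * dot (x - xs) (xs - a)^T + K / (2 * E) * enorm (x - xs) ^+ 2.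
  by rewrite G2; field; rewrite gt_eqF.
lra.
Qed.

(** Three facts enter: regular subgradients are bounded near [xbar], by
    [unit_accumulation] and triviality of the horizon; a minimiser of the
    penalised function is interior, as [p] oscillates by less than 2 near
    [xbar]; and by [penalty_subgradient] it must then be the centre [a], which
    is the Lipschitz inequality at [a]. The limits that define horizon
    subgradients are spelled out with arbitrarily good approximations. *)
Lemma lipschitz_of_trivial_horizon (p : 'rV[R]_n -> R) (xbar : 'rV[R]_n)
    (rho : R) :
  0 < rho ->
  {for xbar, continuous p} ->
  (forall (r K : R) a, 0 < r -> r <= rho -> 0 <= K ->
    exists2 xs, `|xs - xbar| <= r & forall x, `|x - xbar| <= r ->
      p xs + K * enorm (xs - a) <= p x + K * enorm (x - a)) ->
  (forall w, (forall e, 0 < e -> exists x u (t : R), [/\ `|x - xbar| < e,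
       regular_subdiff (EFin \o p) x u, 0 < t, `|t| < e & `|t *: u - w| < e]) ->
     w = 0) ->
  exists r K, [/\ 0 < r, 0 <= K & forall x a, `|x - xbar| < r ->
    `|a - xbar| < r -> `|p x - p a| <= K * enorm (x - a)].
Proof.
move=> rho0 pc attain horizon.
have [e0 e00 sub_le] : exists2 e0, 0 < e0 & forall x u, `|x - xbar| < e0 ->
    regular_subdiff (EFin \o p) x u -> enorm u^T <= e0^-1.
  apply: contrapT => nobound.
  pose P e v := exists x u (t : R), [/\ `|x - xbar| < e,
    regular_subdiff (EFin \o p) x u, 0 < t, `|t| < e & v = (t *: u)^T].
  have [||w w1 wP] := unit_accumulation P.
  - move=> e e' v ee' [x [u [t [xe su t0 te ->]]]].
    by exists x, u, t; split => //; exact: lt_le_trans ee'.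
  - move=> e e_gt0; apply: contrapT => none; apply: nobound.
    exists e => // x u xe su; rewrite leNgt; apply/negP => big; apply: none.
    have u0 : 0 < enorm u^T by apply: lt_trans big; rewrite invr_gt0.
    exists ((enorm u^T)^-1 *: u)^T.
      exists x, u, (enorm u^T)^-1; split => //; rewrite ?invr_gt0//.
      by rewrite gtr0_norm ?invr_gt0// invf_plt.
    by rewrite linearZ /= enormZ gtr0_norm ?invr_gt0// mulVf// gt_eqF.
  have /(congr1 trmx) : w^T = 0.
    apply: horizon => e /wP[v [x [u [t [xe su t0 te ->]]]] vw].
    exists x, u, t; split => //; apply: le_lt_trans vw.
    by rewrite -normr_trmx linearB /= trmxK.
  rewrite trmxK trmx0 => w0; move: w1; rewrite w0 enorm0 => /eqP.
  by rewrite eq_sym oner_eq0.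
have [r1 r10 p_near] := (continuous_epsP _ _).1 pc 1 ltr01.
pose r := Num.min (Num.min (rho / 2) (e0 / 2)) (r1 / 2).
have r0 : 0 < r by rewrite !lt_min !divr_gt0.
have r_rho : r <= rho / 2 by rewrite !ge_min lexx.
have r_e0 : r <= e0 / 2 by rewrite !ge_min lexx orbT.
have r_r1 : r <= r1 / 2 by rewrite !ge_min lexx !orbT.
have rho_r : r <= rho by lra.
(* [K] exceeds the bound on subgradients, and [K * r >= 5] forces the minimiser
   into the half ball around [a] since [p] oscillates by less than 2. *)
pose K := e0^-1 + 5 / r.
have i0 : 0 < e0^-1 by rewrite invr_gt0.
have K0 : 0 < K by rewrite addr_gt0// divr_gt0.
have Kr : 5 <= K * r.
  by rewrite /K mulrDl divfK ?gt_eqF// lerDr mulr_ge0// ltW.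
exists (r / 2), K; split; [by rewrite divr_gt0|exact: ltW|].
have half a x : `|a - xbar| < r / 2 -> `|x - xbar| < r / 2 ->
    p a <= p x + K * enorm (x - a).
  move=> ar xr; have [xs xsr xsmin] := attain r K a r0 rho_r (ltW K0).
  have [xsa|xsa] := eqVneq xs a.
    have := xsmin x; rewrite xsa subrr enorm0 mulr0 addr0; apply; lra.
  have := xsmin a; rewrite subrr enorm0 mulr0 addr0 => xs_a.
  have ar1 : `|a - xbar| < r1 by lra.
  have xsr1 : `|xs - xbar| < r1 by lra.
  have /ltr_normlP[_ pa] := p_near _ ar1.
  have /ltr_normlP[pxs _] := p_near _ xsr1.
  have K_xs : K * enorm (xs - a) < 2.
    have : p xs + K * enorm (xs - a) <= p a by apply: xs_a; lra.
    lra.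
  have xs_near : `|xs - a| < r / 2.
    apply: le_lt_trans (norm_le_enorm _) _.
    by rewrite -(ltr_pM2l K0); lra.
  have xs_in : `|xs - xbar| < r.
    by rewrite -(subrKA a) (le_lt_trans (ler_normD _ _))//; lra.
  have rr : 0 < r - `|xs - xbar| by rewrite subr_gt0.
  have sub := penalty_subgradient p a xs K _ (ltW K0) rr xsa.
  have /sub : forall x0, `|x0 - xs| < r - `|xs - xbar| ->
      p xs + K * enorm (xs - a) <= p x0 + K * enorm (x0 - a).
    move=> y yr; apply: xsmin.
    by rewrite -(subrKA xs) (le_trans (ler_normD _ _))//; lra.
  have xse0 : `|xs - xbar| < e0 by lra.
  move=> /(sub_le _ _ xse0).
  rewrite linearZ /= trmxK enormZ normrN ger0_norm; last first.
    by rewrite divr_ge0 ?enorm_ge0// ltW.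
  rewrite divfK; last by rewrite gt_eqF// enorm_gt0// subr_eq0.
  have : 0 < 5 / r by rewrite divr_gt0.
  by rewrite /K => ? ?; exfalso; lra.
move=> x a xr ar; rewrite ler_norml; apply/andP; split.
  by have := half a x ar xr; lra.
have := half x a xr ar.
have -> : enorm (a - x) = enorm (x - a).
  by rewrite -[a - x]opprB -scaleN1r enormZ normrN1 mul1r.
lra.
Qed.

End LipschitzCriterion.

(** * First-order estimates for the value function *)

Section ValueFunction.
Context {R : realType} {n m q : nat}.
Variables (f : 'rV[R]_(n + m) -> R) (g : 'rV[R]_(n + m) -> 'rV[R]_q).
Variables (xbar : 'rV[R]_n) (ybar : 'rV[R]_m) (V : 'rV[R]_n -> R) (kappa : R).

Local Notation N := (n + m)%N.
Local Notation zbar := (row_mx xbar ybar).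
Local Notation J := ('J g zbar).
Local Notation feas z := (forall i, g z 0 i <= 0).

(** The function [T] of the introduction: the directional derivative at [zbar]
    of the total constraint violation. *)
Definition active_rate (d : 'rV[R]_N) : R :=
  \sum_(i | g zbar 0 i == 0) Num.max ((d *m J) 0 i) 0.

Lemma active_rate_ge0 d : 0 <= active_rate d.
Proof. by apply: sumr_ge0 => i _; rewrite le_max lexx orbT. Qed.

Hypothesis f_C1 : C1_scalar f.
Hypothesis g_C1 : C1_vector g.
Hypothesis zbar_feas : feas zbar.
Hypothesis kappa_ge0 : 0 <= kappa.
(* The distance to the feasible set is an infimum, hence the slack [e]. *)
Hypothesis near_feas : exists2 r, 0 < r & forall z, `|z - zbar| < r ->
  forall e, 0 < e -> exists2 z', feas z' &
    `|z' - z| <= kappa * \sum_i Num.max (g z 0 i) 0 + e.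

(** A constraint inactive at [zbar] stays negative near [zbar], hence
    contributes nothing to the violation. *)
Lemma constraint_growth d i e : 0 < e -> exists2 r, 0 < r &
  forall z t, g z 0 i <= 0 -> `|z - zbar| < r -> 0 < t -> t < r ->
    Num.max (g (z + t *: d) 0 i) 0 <=
    t * ((if g zbar 0 i == 0 then Num.max ((d *m J) 0 i) 0 else 0) + e).
Proof.
move=> e0; have d1 : 0 < `|d| + 1 by rewrite ltr_wpDl.
have near_r r z t : 0 < r -> `|z - zbar| < r / (2 * (`|d| + 1)) -> 0 < t ->
    t < r / (2 * (`|d| + 1)) -> `|z - zbar| < r /\ `|z + t *: d - zbar| < r.
  rewrite !ltr_pdivlMr ?mulr_gt0// => r0 zr t0 tr.
  have z0 := normr_ge0 (z - zbar); have d0 := normr_ge0 d.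
  split; first nra.
  rewrite addrAC (le_lt_trans (ler_normD _ _))// normrZ gtr0_norm//; nra.
case: ifPn => act.
- have [r r0 rP] :=
    C1_strict_diff _ zbar (C1_entry g i g_C1) _ (divr_gt0 e0 d1).
  exists (r / (2 * (`|d| + 1))); first by rewrite divr_gt0 ?mulr_gt0.
  move=> z t gz zr t0 tr; have [z1 z2] := near_r _ _ _ r0 zr t0 tr.
  have := rP _ _ z1 z2.
  have -> : z + t *: d - z = t *: d by rewrite addrAC subrr add0r.
  rewrite grad_entry; last exact: g_C1.1.
  have -> : dot (t *: d) (col i J) = t * (d *m J) 0 i.
    by rewrite dotZl !mxE; congr (_ * _); apply: eq_bigr => j _; rewrite mxE.
  rewrite normrZ gtr0_norm// => /ler_normlW h.
  have le_e : e / (`|d| + 1) * `|d| <= e.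
    by rewrite mulrAC ler_pdivrMr// ler_wpM2l ?ltW// ltrDl.
  rewrite ge_max; apply/andP; split; last first.
    by rewrite mulr_ge0 ?addr_ge0 ?le_max ?lexx ?orbT// ltW.
  set a := (d *m J) 0 i in h *.
  have am : a <= Num.max a 0 by rewrite le_max lexx.
  nra.
- have gi : g zbar 0 i < 0 by rewrite lt_neqAle act zbar_feas.
  have gc : {for zbar, continuous (fun z => g z 0 i)}.
    apply: differentiable_continuous; apply: differentiable_entry.
    exact: g_C1.1.
  have gi' : 0 < - g zbar 0 i by rewrite oppr_gt0.
  have [r r0 rP] := (continuous_epsP _ _).1 gc _ gi'.
  exists (r / (2 * (`|d| + 1))); first by rewrite divr_gt0 ?mulr_gt0.
  move=> z t gz zr t0 tr; have [_ /rP/ltr_normlW h] := near_r _ _ _ r0 zr t0 tr.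
  have te : 0 <= t * (0 + e) by rewrite add0r mulr_ge0 ?ltW.
  by rewrite ge_max te andbT; lra.
Qed.

(** The violation at [z + t *: d] is at most [t * (active_rate d + o(1))] by
    [constraint_growth], and the error bound turns it into a distance. *)
Lemma feasible_shift d e : 0 < e -> exists2 r, 0 < r &
  forall z t, feas z -> `|z - zbar| < r -> 0 < t -> t < r ->
    exists2 z', feas z' &
      `|z' - (z + t *: d)| <= t * (kappa * active_rate d + e).
Proof.
move=> e0; have kq : 0 < 2 * (kappa * q%:R + 1).
  by rewrite mulr_gt0 ?ltr_wpDl ?mulr_ge0.
set e1 := e / (2 * (kappa * q%:R + 1)); have e10 : 0 < e1 by rewrite divr_gt0.
have [||r r0 rP] := uniform_radius (fun i r => forall z t, g z 0 i <= 0 ->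
    `|z - zbar| < r -> 0 < t -> t < r ->
    Num.max (g (z + t *: d) 0 i) 0 <=
    t * ((if g zbar 0 i == 0 then Num.max ((d *m J) 0 i) 0 else 0) + e1)).
- move=> i r s sr H z t gz zs t0 ts.
  by apply: H => //; [exact: lt_le_trans sr|exact: lt_le_trans sr].
- by move=> i; exact: constraint_growth.
have [p p0 pP] := near_feas.
have [a [a0 ap ad]] :=
  small_step _ _ _ r0 (divr_gt0 p0 (ltr0n R 2)) (normr_ge0 d).
exists (Num.min a (p / 2)); first by rewrite lt_min a0 divr_gt0.
move=> z t fz; rewrite !lt_min => /andP[za zp] t0 /andP[ta tp].
have zt : `|z + t *: d - zbar| < p.
  rewrite addrAC (le_lt_trans (ler_normD _ _))// normrZ gtr0_norm//.
  have := normr_ge0 d; nra.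
have te : 0 < t * (e / 2) by rewrite mulr_gt0 ?divr_gt0.
have [z' fz' z'P] := pP _ zt _ te; exists z' => //; apply: le_trans z'P _.
have : \sum_i Num.max (g (z + t *: d) 0 i) 0 <= t * (active_rate d + q%:R * e1).
  apply: (@le_trans _ _ (\sum_i t * ((if g zbar 0 i == 0 then
      Num.max ((d *m J) 0 i) 0 else 0) + e1))).
    apply: ler_sum => i _; apply: rP => //; first exact: lt_trans ap.
    exact: lt_trans ap.
  rewrite -mulr_sumr big_split /= -big_mkcond /= sumr_const card_ord.
  by rewrite mulr_natl.
move=> h; apply: (@le_trans _ _
    (kappa * (t * (active_rate d + q%:R * e1)) + t * (e / 2))).
  by rewrite lerD2r ler_wpM2l.
have e1E : e1 * (2 * (kappa * q%:R + 1)) = e by rewrite divfK ?gt_eqF.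
have : kappa * q%:R * e1 <= e / 2 by lra.
nra.
Qed.

Hypothesis V_ub : forall z, feas z -> f z <= V (lsubmx z).
Hypothesis V_attained : forall e, 0 < e -> exists2 r, 0 < r &
  forall x, `|x - xbar| < r -> exists z,
    [/\ lsubmx z = x, `|z - zbar| < e, feas z & f z = V x].

Lemma col_mx0_norm_le (w : 'cV[R]_n) : `|col_mx w (0 : 'cV[R]_m)| <= `|w|.
Proof.
rewrite -normr_trmx tr_col_mx trmx0.
by apply: row_mx_norm_le; rewrite ?normr_trmx ?normr0.
Qed.

(** Functions of [x] alone have gradients with zero [y]-block. *)
Lemma dot_col_mx0 (d : 'rV[R]_N) (w : 'cV[R]_n) :
  dot d (col_mx w (0 : 'cV[R]_m)) = dot (lsubmx d) w.
Proof. by rewrite -[in LHS](hsubmxK d) mul_row_col mulmx0 addr0. Qed.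

(** Let [z] attain [V x] and let [z'] be the feasible point obtained from [z +
    t *: d]. Feasibility of [z'] and the subgradient inequality give [<z' - z,
    (u, 0) + grad f> <= o(t)], while [z' - z] is [t *: d] up to [t * kappa * T
    d]. The scale [t -> s] makes limiting ([s = 1]) and horizon ([s = 0])
    subgradients two cases of one statement. *)
Lemma subgradient_estimate (w : 'cV[R]_n) (s : R) :
  (forall e, 0 < e -> exists x u (t : R), [/\ `|x - xbar| < e,
     regular_subdiff (EFin \o (fun x => - V x)) x u, 0 < t, `|t - s| < e &
     `|t *: u - w| < e]) ->
  forall d, dot d (col_mx w 0 + s *: grad f zbar) <=
    N%:R * kappa * `|col_mx w 0 + s *: grad f zbar| * active_rate d.
Proof.
set eta := col_mx w 0 + _ => approx d.
set T := active_rate d; have T0 : 0 <= T by exact: active_rate_ge0.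
pose gf := grad f zbar.
have kT0 : 0 <= kappa * T by rewrite mulr_ge0.
have d0 := normr_ge0 d; have gf0 := normr_ge0 gf; have eta0 := normr_ge0 eta.
have N0 : 0 <= N%:R :> R by [].
apply: (@ler_addMeps _ _ _ (2 * (`|s| + 1) * (`|d| + kappa * T + 1) +
  N%:R * `|eta| + N%:R * (kappa * T + 1 + `|d|) * (1 + `|gf|))) => e e0 e1.
set E := kappa * T + e; set D := `|d| + E.
have E0 : 0 <= E by rewrite addr_ge0// ltW.
have D0 : 0 <= D by rewrite addr_ge0.
have [r1 r10 shiftP] := feasible_shift d e e0.
have [r2 r20 fP] := C1_strict_diff f zbar f_C1 _ e0.
have m0 : 0 < Num.min r1 (r2 / 2) by rewrite lt_min r10 divr_gt0.
have [r3 r30 attP] := V_attained _ m0.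
have m1 : 0 < Num.min r3 e by rewrite lt_min r30.
have [x [u [s' [+ subu s'0 + +]]]] := approx _ m1.
rewrite !lt_min => /andP[xr3 _] /andP[_ ss'] /andP[_ s'u].
have [z [zx]] := attP _ xr3.
rewrite lt_min => /andP[zr1 zr2] zfeas zV.
have [p p0 subP] := regular_subdiff_eps _ _ _ subu _ e0.
have m2 : 0 < Num.min p (r2 / 2) by rewrite lt_min p0 divr_gt0.
have [t [t0 tr1]] := small_step _ _ _ r10 m2 D0.
rewrite lt_min => /andP[tp tr2].
have [z' z'feas z'P] := shiftP _ _ zfeas zr1 t0 tr1.
set c := z' - (z + t *: d) in z'P.
have zc : z' - z = t *: d + c by apply/rowP => i; rewrite /c !mxE; ring.
have zD : `|z' - z| <= t * D.
  rewrite zc (le_trans (ler_normD _ _))// normrZ gtr0_norm// /D mulrDr lerD2l.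
  exact: z'P.
have xD : `|lsubmx z' - x| <= t * D.
  by rewrite -zx -linearB (le_trans (lsubmx_norm_le _)).
have zr : `|z - zbar| < r2 by lra.
have z'r : `|z' - zbar| < r2.
  by rewrite -(subrKA z) (le_lt_trans (ler_normD _ _))//; lra.
have /ler_normlP[f_low _] := fP _ _ zr z'r.
have /subP : `|lsubmx z' - x| < p by lra.
have := V_ub _ z'feas; rewrite -zV /= => V_low sub_low.
pose zeta := col_mx u 0 + gf.
have steep : dot (z' - z) zeta <= t * (2 * e * D).
  rewrite dotDr dot_col_mx0 linearB /= zx.
  have : e * `|z' - z| <= e * (t * D) by rewrite ler_wpM2l// ltW.
  have : e * `|lsubmx z' - x| <= e * (t * D) by rewrite ler_wpM2l// ltW.
  rewrite -/gf in f_low; lra.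
have along : dot d zeta <= 2 * e * D + N%:R * E * `|zeta|.
  rewrite -(ler_pM2l t0) mulrDr.
  have -> : t * dot d zeta = dot (z' - z) zeta - dot c zeta.
    by rewrite zc dotDl dotZl addrK.
  have /ler_normlP[+ _] := dot_norm_le c zeta.
  have : N%:R * `|c| * `|zeta| <= t * (N%:R * E * `|zeta|).
    by rewrite mulrA ler_wpM2r// mulrCA ler_wpM2l.
  lra.
have diff : `|s' *: zeta - eta| <= e * (1 + `|gf|).
  have -> : s' *: zeta - eta = col_mx (s' *: u - w) 0 + (s' - s) *: gf.
    apply/colP => i; rewrite /zeta /eta -/gf !mxE.
    by case: (fintype.split i) => j; rewrite !mxE; ring.
  rewrite (le_trans (ler_normD _ _))// mulrDr mulr1 lerD//.
    exact: le_trans (col_mx0_norm_le _) (ltW s'u).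
  by rewrite normrZ ler_wpM2r// ltW.
have s'1 : s' <= `|s| + 1.
  have /ltr_normlP[_] := ss'; have := ler_norm s; lra.
have zeta_le : `|s' *: zeta| <= `|eta| + e * (1 + `|gf|).
  rewrite -(subrK eta (s' *: zeta)) addrC (le_trans (ler_normD _ _))//.
  by rewrite lerD2l.
have -> : dot d eta = s' * dot d zeta - dot d (s' *: zeta - eta).
  by rewrite dotBr dotZr opprB addrC subrK.
have /ler_normlP[tail _] := dot_norm_le d (s' *: zeta - eta).
have tail' : N%:R * `|d| * `|s' *: zeta - eta| <=
    N%:R * `|d| * (e * (1 + `|gf|)).
  by rewrite ler_wpM2l// mulr_ge0.
have main : s' * dot d zeta <= 2 * e * (`|s| + 1) * (`|d| + kappa * T + 1) +
    N%:R * E * (`|eta| + e * (1 + `|gf|)).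
  apply: (@le_trans _ _ (s' * (2 * e * D + N%:R * E * `|zeta|))).
    by rewrite ler_wpM2l// ltW.
  rewrite mulrDr lerD//.
    rewrite mulrCA -!mulrA; apply: ler_wpM2l => //.
    apply: ler_wpM2l; first exact: ltW.
    by apply: ler_pM => //; [exact: ltW|rewrite /D /E; lra].
  rewrite mulrCA; apply: ler_wpM2l; first by rewrite mulr_ge0.
  by move: zeta_le; rewrite normrZ gtr0_norm.
have e_small : N%:R * e * (e * (1 + `|gf|)) <= N%:R * e * (1 * (1 + `|gf|)).
  apply: ler_wpM2l; first by rewrite mulr_ge0// ltW.
  by apply: ler_wpM2r; [rewrite addr_ge0|exact: ltW].
rewrite /E in main; clear -main tail tail' e_small; lra.
Qed.

(** A lower bound on [V x] in terms of [V] at [x' = x - t *: d_x] is needed,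
    and it comes from moving forward along [d] from a maximiser over [x']: the
    repaired point lies over [x] up to [t * kappa * T d], a gap that costs [K]
    times as much by Lipschitz continuity. *)
Lemma supergradient_estimate (w : 'cV[R]_n) (K r0 : R) : 0 <= K -> 0 < r0 ->
  (forall x x', `|x - xbar| < r0 -> `|x' - xbar| < r0 ->
    `|V x - V x'| <= K * `|x - x'|) ->
  (forall e, 0 < e -> exists x u, [/\ `|x - xbar| < e,
     regular_subdiff (EFin \o V) x u & `|u - w| < e]) ->
  forall d, dot d (grad f zbar - col_mx w 0) <=
    kappa * (K + N%:R * `|grad f zbar|) * active_rate d.
Proof.
move=> K0 r00 lipV approx d; pose gf := grad f zbar; rewrite -/gf.
set T := active_rate d; have T0 : 0 <= T by exact: active_rate_ge0.
have kT0 : 0 <= kappa * T by rewrite mulr_ge0.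
have d0 := normr_ge0 d; have gf0 := normr_ge0 gf.
have dx_le := lsubmx_norm_le d; have dx0 := normr_ge0 (lsubmx d).
have N0 : 0 <= N%:R :> R by [].
apply: (@ler_addMeps _ _ _ (K + N%:R * `|gf| + (`|d| + kappa * T + 1) + `|d| +
  n%:R * `|d|)) => e e0 e1.
set E := kappa * T + e; set D := `|d| + E.
have E0 : 0 <= E by rewrite addr_ge0// ltW.
have D0 : 0 <= D by rewrite addr_ge0.
have [r1 r10 shiftP] := feasible_shift d e e0.
have [r2 r20 fP] := C1_strict_diff f zbar f_C1 _ e0.
have m0 : 0 < Num.min r1 (r2 / 2) by rewrite lt_min r10 divr_gt0.
have [r3 r30 attP] := V_attained _ m0.
have m1 : 0 < Num.min (Num.min (r3 / 2) (r0 / 2)) e.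
  by rewrite !lt_min e0 !divr_gt0.
have [x [u [+ subu +]]] := approx _ m1.
rewrite !lt_min => /andP[/andP[xr3 xr0] _] /andP[_ uw].
have [p p0 subP] := regular_subdiff_eps _ _ _ subu _ e0.
have m2 : 0 < Num.min (Num.min p (r2 / 2)) (Num.min (r3 / 2) (r0 / 2)).
  by rewrite !lt_min p0 !divr_gt0.
have [t [t0 tr1]] := small_step _ _ _ r10 m2 D0.
rewrite !lt_min => /andP[/andP[tp tr2] /andP[tr3 tr0]].
have tdD : t * `|d| <= t * D.
  by apply: ler_wpM2l; [exact: ltW|rewrite /D lerDl].
have tdx : `|t *: lsubmx d| <= t * D.
  rewrite normrZ gtr0_norm//; apply: le_trans tdD.
  by apply: ler_wpM2l => //; exact: ltW.
pose x' := x - t *: lsubmx d.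
have x'xE : x' - x = - (t *: lsubmx d) by rewrite /x' addrAC subrr add0r.
have x'x : `|x' - x| <= t * D by rewrite x'xE normrN.
have x'r3 : `|x' - xbar| < r3.
  by rewrite -(subrKA x) (le_lt_trans (ler_normD _ _))//; lra.
have [z [zx]] := attP _ x'r3.
rewrite lt_min => /andP[zr1 zr2] zfeas zV.
have [z' z'feas z'P] := shiftP _ _ zfeas zr1 t0 tr1.
set c := z' - (z + t *: d) in z'P; rewrite -/T -/E in z'P.
have zc : z' - z = t *: d + c by apply/rowP => i; rewrite /c !mxE; ring.
have zD : `|z' - z| <= t * D.
  rewrite zc (le_trans (ler_normD _ _))// normrZ gtr0_norm// /D mulrDr lerD2l.
  exact: z'P.
have x_c : lsubmx z' - x = lsubmx c.
  rewrite /c linearB linearD /= zx /x' linearZ /=.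
  by apply/rowP => i; rewrite !mxE; ring.
have zr : `|z - zbar| < r2 by lra.
have z'r : `|z' - zbar| < r2.
  by rewrite -(subrKA z) (le_lt_trans (ler_normD _ _))//; lra.
have tE_D : t * E <= t * D.
  by apply: ler_wpM2l; [exact: ltW|rewrite /D lerDr].
have xr0' : `|x - xbar| < r0 by lra.
have c_le := lsubmx_norm_le c.
have z'r0 : `|lsubmx z' - xbar| < r0.
  by rewrite -(subrKA x) (le_lt_trans (ler_normD _ _))// x_c; lra.
have /ler_normlP[f_low _] := fP _ _ zr z'r.
have /subP : `|x' - x| < p by lra.
have /ler_normlP[lip_low _] := lipV _ _ xr0' z'r0.
have := V_ub _ z'feas => V_low; rewrite -zV => sub_low.
have lip_c : K * `|x - lsubmx z'| <= t * (K * E).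
  rewrite distrC x_c mulrCA; apply: ler_wpM2l => //.
  exact: le_trans c_le z'P.
have e_z : e * `|z' - z| <= t * (e * D).
  by rewrite mulrCA; apply: ler_wpM2l => //; exact: ltW.
have e_x : e * `|x' - x| <= t * (e * `|d|).
  rewrite x'xE normrN normrZ gtr0_norm// mulrCA.
  by do 2!(apply: ler_wpM2l; first exact: ltW).
have split_z : dot (z' - z) gf = t * dot d gf + dot c gf.
  by rewrite zc dotDl dotZl.
have split_x : dot (x' - x) u = - (t * dot (lsubmx d) u).
  by rewrite x'xE mulNmx mxE dotZl.
have /ler_normlP[c_gf _] := dot_norm_le c gf.
have c_gf' : N%:R * `|c| * `|gf| <= t * (N%:R * E * `|gf|).
  by rewrite mulrA ler_wpM2r// mulrCA ler_wpM2l.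
have along : dot d gf - dot (lsubmx d) u <=
    K * E + N%:R * E * `|gf| + e * D + e * `|d|.
  rewrite -(ler_pM2l t0).
  rewrite -/gf split_z in f_low; rewrite split_x in sub_low.
  clear -f_low lip_low V_low sub_low lip_c e_z e_x c_gf c_gf'; lra.
rewrite dotBr dot_col_mx0.
have -> : dot (lsubmx d) w = dot (lsubmx d) u - dot (lsubmx d) (u - w).
  by rewrite dotBr opprB addrC subrK.
have /ler_normlP[_ tail] := dot_norm_le (lsubmx d) (u - w).
have tail' : n%:R * `|lsubmx d| * `|u - w| <= n%:R * `|d| * e.
  by apply: ler_pM; rewrite ?mulr_ge0 ?ler_wpM2l// ltW.
have e_small : e * e <= e * 1 by rewrite ler_wpM2l// ltW.
rewrite /D /E in along; clear -along tail tail' e_small; lra.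
Qed.

Lemma value_continuous : f zbar = V xbar -> {for xbar, continuous V}.
Proof.
move=> zV; apply/continuous_epsP => e e0.
have fc : {for zbar, continuous f}.
  by apply: differentiable_continuous; exact: f_C1.1.
have [r1 r10 r1P] := (continuous_epsP _ _).1 fc _ e0.
have [r r0 rP] := V_attained _ r10; exists r => // x /rP[z [_ zr _ <-]].
by rewrite -zV; exact: r1P.
Qed.

(** [V] need not be upper semi-continuous, as the feasible sets may be
    unbounded; but near [xbar] the supremum is attained near [ybar], so the
    minimisation can be carried out over a compact set of pairs [(x, y)]. *)
Lemma penalized_value_attained : exists2 rho, 0 < rho &
  forall (r K : R) a, 0 < r -> r <= rho -> 0 <= K ->
    exists2 xs, `|xs - xbar| <= r & forall x, `|x - xbar| <= r ->
      - V xs + K * enorm (xs - a) <= - V x + K * enorm (x - a).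
Proof.
have [r1 r10 attP] := V_attained 1 ltr01.
exists (r1 / 2) => [|r K a r0 rr1 K0]; first by rewrite divr_gt0.
have lsubC : continuous (lsubmx : 'rV[R]_N -> 'rV[R]_n).
  move=> z; apply/continuous_epsP => e e0; exists e => // z' z'e.
  by rewrite -linearB; exact: le_lt_trans (lsubmx_norm_le _) z'e.
have distC k (b : 'rV[R]_k) : continuous (fun x : 'rV[R]_k => `|x - b|).
  move=> x; apply/continuous_epsP => e e0; exists e => // x' x'e.
  apply: le_lt_trans x'e; rewrite (le_trans (ler_dist_dist _ _))//.
  by rewrite opprB addrA subrK.
pose S := [set z | feas z] `&` ([set z | `|lsubmx z - xbar| <= r] `&`
  [set z : 'rV[R]_N | `|z - zbar| <= 1]).
have cS : compact S.
  apply: bounded_closed_compact.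
    exists (`|zbar| + 1); split; first exact: num_real.
    move=> M M1 z [_ [_ /= z1]]; apply: ltW; apply: le_lt_trans M1.
    by rewrite -(subrK zbar z) addrC (le_trans (ler_normD _ _))// lerD2l.
  apply: closedI.
    have -> : [set z | feas z] =
        \bigcap_(i in [set: 'I_q]) [set z | g z 0 i <= 0].
      by apply/seteqP; split=> z /= H i; [move=> _; exact: H|exact: (H i I)].
    apply: closed_bigI => i _.
    have gC : continuous (fun z => g z 0 i).
      move=> z; apply: differentiable_continuous.
      by apply: differentiable_entry; exact: g_C1.1.
    apply: (@preimage_closed _ _ (fun z => g z 0 i) [set t : R | t <= 0]).
      by move=> z _; exact: gC.
    exact: closed_le.
  apply: closedI.
    apply: (@preimage_closed _ _ (fun z => `|lsubmx z - xbar|)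
      [set t : R | t <= r]).
      move=> z _; apply/continuous_epsP => e e0; exists e => // z' z'e.
      apply: le_lt_trans (ler_dist_dist _ _) _.
      rewrite opprB addrA subrK -linearB.
      exact: le_lt_trans (lsubmx_norm_le _) z'e.
    exact: closed_le.
  apply: (@preimage_closed _ _ (fun z : 'rV[R]_N => `|z - zbar|)
    [set t : R | t <= 1]).
    by move=> z _; exact: distC.
  exact: closed_le.
pose F (z : 'rV[R]_N) := - f z + K * enorm (lsubmx z - a).
have FC : {within S, continuous F}.
  apply: continuous_subspaceT => z.
  have fc : {for z, continuous f}.
    by apply: differentiable_continuous; exact: f_C1.1.
  have ec : {for z, continuous (fun z : 'rV[R]_N => enorm (lsubmx z - a))}.
    exact: (continuous_comp (lsubC z) (enorm_continuous a _)).
  exact: (cvgD (cvgN fc) (cvgM (cvg_cst K) ec)).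
have S0 : S !=set0.
  exists zbar; split => //; split => /=.
    by rewrite row_mxKl subrr normr0 ltW.
  by rewrite subrr normr0.
have [zs /set_mem[zs_feas [/= zs_x _]] zs_min] := EVT_min_rV S0 cS FC.
exists (lsubmx zs) => // x xr.
have xr1 : `|x - xbar| < r1 by lra.
have [z [zx z1 z_feas zV]] := attP _ xr1.
have zS : z \in S by apply/mem_set; split => //; split => /=; rewrite ?zx// ltW.
have := zs_min _ zS; rewrite /F zx zV; apply: le_trans.
by rewrite lerD2r lerN2 V_ub.
Qed.

(** Reads the [x]- and [y]-blocks of [box_multiplier]; coefficients supported
    on the active constraints are the complementary ones. *)
Lemma multiplier_of_estimate (w : 'cV[R]_n) (s M : R) : 0 <= M ->
  (forall d, dot d (col_mx w 0 + s *: grad f zbar) <= M * active_rate d) ->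
  exists l, [/\ complementary g xbar ybar l,
    w + s *: usubmx (grad f zbar) = usubmx J *m l &
    s *: dsubmx (grad f zbar) = dsubmx J *m l].
Proof.
move=> M0 /(box_multiplier J (fun i => g zbar 0 i == 0) M _ M0).
move=> [l [l0 lact etaE]].
exists l; split.
- split=> // [i|]; first by rewrite oppr_ge0.
  apply/rowP => j; rewrite (ord1 j) !mxE big1 // => i _; rewrite mxE.
  have [->|/lact ->] := eqVneq (g zbar 0 i) 0; first by rewrite oppr0 mul0r.
  by rewrite mulr0.
- by rewrite mul_usub_mx -etaE linearD linearZ /= col_mxKu.
- by rewrite mul_dsub_mx -etaE linearD linearZ /= col_mxKd add0r.
Qed.
End ValueFunction.

(** * Consequences of inner semi-continuity and of the error bound *)

Lemma cvg_near_norm {R : realType} {W : normedModType R} (u : nat -> W) l e :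
  u k @[k --> \oo] --> l -> 0 < e -> \forall k \near \oo, `|u k - l| < e.
Proof. by move=> /cvgr_distC_lt; exact. Qed.

Section InnerSemicontinuity.
Context {R : realType} {n m q : nat}.
Variables (f : 'rV[R]_(n + m) -> R) (g : 'rV[R]_(n + m) -> 'rV[R]_q).
Variables (xbar : 'rV[R]_n) (ybar : 'rV[R]_m).
Hypothesis S_isc : inner_semicontinuous f g xbar ybar.

(** The sequence that starts at [x] and is then constant equal to [xbar] is
    admissible in the definition of inner semi-continuity. *)
Lemma solutions_nonempty x : exists y, solutions f g x y.
Proof.
have xk : (if k == 0%N then x else xbar) @[k --> \oo] --> xbar.
  apply: cvg_near_cst; exists 1%N => // k /= k1.
  by rewrite gtn_eqF.
by have [yk [solk _]] := S_isc _ xk; exists (yk 0%N); exact: (solk 0%N).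
Qed.

Lemma Vsup_EFin x : Vsup f g x = (fine (Vsup f g x))%:E.
Proof. by have [y [_ <-]] := solutions_nonempty x. Qed.

Lemma Vsup_upper_bound z : (forall i, g z 0 i <= 0) ->
  f z <= fine (Vsup f g (lsubmx z)).
Proof.
move=> fz; rewrite -lee_fin -Vsup_EFin; apply: ereal_sup_ubound.
by exists (rsubmx z); rewrite ?hsubmxK // /feasible /= hsubmxK.
Qed.

Lemma solutions_near e : 0 < e -> exists2 r, 0 < r &
  forall x, `|x - xbar| < r -> exists z,
    [/\ lsubmx z = x, `|z - row_mx xbar ybar| < e,
    forall i, g z 0 i <= 0 & f z = fine (Vsup f g x)].
Proof.
move=> e0; apply: contrapT => none.
have far k : exists x : 'rV[R]_n, `|x - xbar| < k.+1%:R^-1 /\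
    forall y, solutions f g x y -> e / 2 <= `|row_mx x y - row_mx xbar ybar|.
  apply: contrapT => near_sol; apply: none; exists k.+1%:R^-1 => // x xk.
  apply: contrapT => no_z; apply: near_sol; exists x; split => // y [fy yV].
  rewrite leNgt; apply/negP => ye; apply: no_z; exists (row_mx x y).
  split => //; first by rewrite row_mxKl.
    by lra.
  by rewrite -yV.
have [xk xkP] := choice far.
have xk_cvg : xk k @[k --> \oo] --> xbar.
  apply/cvgrPdist_lt => d d0.
  have [k0 _ k0P] := near_infty_natSinv_lt (PosNum d0).
  exists k0 => // k /= /k0P; apply: lt_trans; rewrite distrC.
  exact: (xkP k).1.
have [yk [solk yk_cvg]] := S_isc _ xk_cvg.
have e4 : 0 < e / 4 by rewrite divr_gt0.
have near_x := cvg_near_norm _ _ _ xk_cvg e4.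
have near_y := cvg_near_norm _ _ _ yk_cvg e4.
have [k [kx ky]] := filter_ex (filterI near_x near_y).
have := (xkP k).2 _ (solk k); apply/negP; rewrite -ltNge.
apply: (@le_lt_trans _ _ (e / 4)); last by lra.
rewrite opp_row_mx add_row_mx; by apply: row_mx_norm_le; rewrite ltW.
Qed.

End InnerSemicontinuity.

Lemma error_bound_near_feasible {R : realType} {n m q : nat}
    (g : 'rV[R]_(n + m) -> 'rV[R]_q) xbar ybar :
  local_error_bound g xbar ybar -> exists2 kappa, 0 <= kappa &
  exists2 r, 0 < r & forall z, `|z - row_mx xbar ybar| < r ->
    forall e, 0 < e -> exists2 z', forall i, g z' 0 i <= 0 &
      `|z' - z| <= kappa * \sum_i Num.max (g z 0 i) 0 + e.
Proof.
move=> [kappa [delta [k0 d0 H]]]; exists kappa; first exact: ltW.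
exists (delta / (n + m).+1%:R) => [|z]; first by rewrite divr_gt0.
rewrite ltr_pdivlMr// mulrC => zd e e0.
have ze : enorm (z - row_mx xbar ybar) < delta.
  apply: le_lt_trans zd; apply: le_trans (enorm_le_norm _) _.
  by rewrite ler_wpM2r// ler_nat.
have : (dist_to z [set z' | forall i, (g z' 0 i <= 0)%R] <
    (kappa * \sum_(i < q) Num.max (g z 0 i) 0 + e)%:E)%E.
  by apply: le_lt_trans (H _ ze) _; rewrite lte_fin ltrDl.
move=> /ereal_inf_lt[_ [z' fz' <-]]; rewrite lte_fin => h.
exists z' => //; rewrite distrC; apply: le_trans (norm_le_enorm _) _.
exact: ltW.
Qed.

(** * The value function theorem *)

Theorem theorem3p1 (R : realType) (n m q : nat)
    (f : 'rV[R]_(n + m) -> R) (g : 'rV[R]_(n + m) -> 'rV[R]_q)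
    (xbar : 'rV[R]_n) (ybar : 'rV[R]_m)
    (f_C1 : C1_scalar f) (g_C1 : C1_vector g)
    (ybar_sol : solutions f g xbar ybar)
    (S_isc : inner_semicontinuous f g xbar ybar)
    (g_leb : local_error_bound g xbar ybar) :
  [/\ {for xbar, continuous (Vsup f g)},
      limiting_subdiff (vinf f g) xbar `<=`
        [set - nabla_x_L f g xbar ybar l | l in Sigma f g xbar ybar],
      horizon_subdiff (vinf f g) xbar `<=`
        [set nabla_x_g g xbar ybar *m l | l in Sigma0 g xbar ybar] &
      [set nabla_x_g g xbar ybar *m l | l in Sigma0 g xbar ybar] = [set 0] ->
      [/\ lipschitz_at (Vsup f g) xbar,
          limiting_subdiff (Vsup f g) xbar `<=`
            clarke_subdiff (Vsup f g) xbar &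
          clarke_subdiff (Vsup f g) xbar `<=`
            [set nabla_x_L f g xbar ybar l | l in Sigma f g xbar ybar]]].
Proof.
pose V x := fine (Vsup f g x); pose zbar := row_mx xbar ybar.
have VE : Vsup f g = EFin \o V by apply/funext => x; exact: Vsup_EFin S_isc x.
have vE : vinf f g = EFin \o (fun x => - V x).
  by apply/funext => x; rewrite vinfE VE.
have [ybar_feas ybar_opt] := ybar_sol.
have zbarV : f zbar = V xbar by rewrite /V -ybar_opt.
have Vub := Vsup_upper_bound f g xbar ybar S_isc.
have Vatt := solutions_near f g xbar ybar S_isc.
have [kappa kappa0 near_feas] := error_bound_near_feasible _ _ _ g_leb.
have V_cont : {for xbar, continuous V}.
  exact: value_continuous f g xbar ybar V f_C1 Vatt zbarV.
have LE l : grad (lagrangian f g l) zbar = grad f zbar - 'J g zbar *m l.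
  by apply: grad_lagrangian; [exact: f_C1.1|exact: g_C1.1].
have xLE l : nabla_x_L f g xbar ybar l =
    usubmx (grad f zbar) - usubmx ('J g zbar) *m l.
  by rewrite /nabla_x_L LE linearB /= mul_usub_mx.
have yLE l : nabla_y_L f g xbar ybar l =
    dsubmx (grad f zbar) - dsubmx ('J g zbar) *m l.
  by rewrite /nabla_y_L LE linearB /= mul_dsub_mx.
have multiplier w s : (forall e, 0 < e -> exists x u (t : R),
    [/\ `|x - xbar| < e, regular_subdiff (vinf f g) x u, 0 < t, `|t - s| < e &
        `|t *: u - w| < e]) ->
    exists l, [/\ complementary g xbar ybar l,
      w + s *: usubmx (grad f zbar) = usubmx ('J g zbar) *m l &
      s *: dsubmx (grad f zbar) = dsubmx ('J g zbar) *m l].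
  rewrite vE => approx.
  have est := subgradient_estimate f g xbar ybar V kappa f_C1 g_C1 ybar_feas
    kappa0 near_feas Vub Vatt w s approx.
  apply: multiplier_of_estimate ybar_feas _ _ _ _ est.
  by rewrite !mulr_ge0.
have sub_v : limiting_subdiff (vinf f g) xbar `<=`
    [set - nabla_x_L f g xbar ybar l | l in Sigma f g xbar ybar].
  move=> w [_ [xk [wk [xkc _ sub wkc]]]].
  have [e e0|l [cl xl yl]] := multiplier w 1.
    have [k [kx kw]] := filter_ex (filterI (cvg_near_norm _ _ _ xkc e0)
      (cvg_near_norm _ _ _ wkc e0)).
    by exists (xk k), (wk k), 1; split; rewrite ?ltr01 ?subrr ?normr0 ?scale1r.
  exists l; first by split=> //; rewrite yLE -yl scale1r subrr.
  by rewrite xLE -xl scale1r opprB addrK.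
have sub_oo : horizon_subdiff (vinf f g) xbar `<=`
    [set nabla_x_g g xbar ybar *m l | l in Sigma0 g xbar ybar].
  move=> w [_ [xk [wk [tk [xkc _ sub [tk0 tkc] wkc]]]]].
  have [e e0|l [cl xl yl]] := multiplier w 0.
    have [k [[kx kt] kw]] := filter_ex (filterI (filterI
      (cvg_near_norm _ _ _ xkc e0) (cvg_near_norm _ _ _ tkc e0))
      (cvg_near_norm _ _ _ wkc e0)).
    by exists (xk k), (wk k), (tk k); split.
  exists l; first by split=> //; rewrite /nabla_y_g -yl scale0r.
  by rewrite /nabla_x_g -xl scale0r addr0.
split=> //.
  rewrite VE; apply: (continuous_comp V_cont).
  by apply: cvg_EFin; [exact: nearW|exact: cvg_id].
move=> Sigma0_trivial.
have [rho rho0 attain] := penalized_value_attained f g xbar ybar V f_C1 g_C1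
  ybar_feas Vub Vatt.
have [r [K [r0 K0 lip]]] : exists r K, [/\ 0 < r, 0 <= K &
    forall x a, `|x - xbar| < r -> `|a - xbar| < r ->
    `|- V x - - V a| <= K * enorm (x - a)].
  apply: lipschitz_of_trivial_horizon rho0 _ attain _.
    exact: (cvgN V_cont).
  move=> w approx; have [e e0|l [cl xl yl]] := multiplier w 0.
    have [x [u [t [xe su t0 te tw]]]] := approx e e0.
    by exists x, u, t; split; rewrite ?subr0 ?vE.
  have : [set 0] w.
    rewrite -Sigma0_trivial; exists l.
      by split=> //; rewrite /nabla_y_g -yl scale0r.
    by rewrite /nabla_x_g -xl scale0r addr0.
  exact.
have lipV x a : `|x - xbar| < r -> `|a - xbar| < r ->
    `|V x - V a| <= K * enorm (x - a).
  by move=> xr ar; have := lip x a xr ar; rewrite -opprD normrN.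
have sub_V : limiting_subdiff (Vsup f g) xbar `<=`
    [set nabla_x_L f g xbar ybar l | l in Sigma f g xbar ybar].
  move=> w [_ [xk [wk [xkc _ sub wkc]]]].
  have lip_norm x a : `|x - xbar| < r -> `|a - xbar| < r ->
      `|V x - V a| <= K * n%:R * `|x - a|.
    move=> xr ar; apply: le_trans (lipV _ _ xr ar) _.
    by rewrite -mulrA ler_wpM2l// enorm_le_norm.
  have Kn0 : 0 <= K * n%:R by rewrite mulr_ge0.
  have est := supergradient_estimate f g xbar ybar V kappa f_C1 g_C1 ybar_feas
    kappa0 near_feas Vub Vatt w _ r Kn0 r0 lip_norm.
  have [||l [cl xl yl]] := multiplier_of_estimate f g xbar ybar ybar_feas (- w)
    1 (kappa * (K * n%:R + (n + m)%:R * `|grad f zbar|)).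
  - by rewrite mulr_ge0// addr_ge0// mulr_ge0.
  - move=> d; have -> : col_mx (- w) 0 + 1 *: grad f zbar =
        grad f zbar - col_mx w 0.
      by rewrite scale1r opp_col_mx oppr0 addrC.
    apply: est => e e0.
    have [k [kx kw]] := filter_ex (filterI (cvg_near_norm _ _ _ xkc e0)
      (cvg_near_norm _ _ _ wkc e0)).
    by exists (xk k), (wk k); split => //; rewrite -VE.
  exists l; first by split=> //; rewrite yLE -yl scale1r subrr.
  by rewrite xLE -xl scale1r opprD opprK addrCA subrr addr0.
split.
- exists K, [set x | `|x - xbar| < r]; split.
  + apply/nbhs_ballP; exists r => // x /=; by rewrite -ball_normE /= distrC.
  + by move=> x _; rewrite VE.
  + by move=> x a xr ar; exact: lipV.
- exact: sub_gen_smallest.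
- apply: smallest_sub => //; apply/convex_setW => a b.
  move=> /set_mem[l [yl [gl l0 cl]] <-].
  move=> /set_mem[l' [yl' [_ l'0 cl']] <-] t t0 t1.
  apply/mem_set; exists (t%:num *: l + (1 - t%:num) *: l').
    split.
      move: yl yl'; rewrite !yLE => /subr0_eq yl /subr0_eq yl'.
      rewrite mulmxDr -!scalemxAr -yl -yl' -scalerDl [_ + (1 - _)]addrC.
      by rewrite subrK scale1r subrr.
    split=> // [i|].
      by rewrite !mxE addr_ge0// mulr_ge0 ?subr_ge0// ltW.
    by rewrite mulmxDr -!scalemxAr cl cl' !scaler0 addr0.
  rewrite !xLE mulmxDr -!scalemxAr.
  transitivity (t%:num *: (usubmx (grad f zbar) - usubmx ('J g zbar) *m l) +
    (1 - t%:num) *: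
      (usubmx (grad f zbar) - usubmx ('J g zbar) *m l')); last by [].
  by apply/colP => i; rewrite !mxE; ring.
Qed.
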